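(* Let $m\le d$ be positive integers and define $$h=h(d,m,2)=\begin{cases}5 & \text{if } m=1,\\ 7 & \text{if } m=2,\\ 3m & \text{if } m\neq 1 \text{ is odd},\\ 3m-1 & \text{if } m\neq 2 \text{ is even}.\end{cases}$$ Then for every finite family $\mathcal{F}$ of $m$-boxes in $\mathbb{R}^d$, $\mathcal{F}$ is $2$-pierceable if and only if every subfamily of $\mathcal{F}$ of cardinality $h$ (every subfamily, if $\mathcal{F}$ has fewer than $h$ members) is $2$-pierceable.
   Context: An $m$-box in $\mathbb{R}^d$ ($m\le d$) is a rectangular $m$-dimensional parallelotope in $\mathbb{R}^d$ whose edges are parallel to the coordinate axes, i.e. a set $I_1\times\cdots\times I_d$ of compact intervals $I_j\subset\mathbb{R}$ of which exactly $m$ are nondegenerate and the remaining $d-m$ are single points. A family of sets is $n$-pierceable if there exists a set of $n$ points such that each member of the family contains at least one of these points. *)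

(* Defs.v *)
From mathcomp Require Import all_boot all_order all_algebra finmap.
From mathcomp Require Import all_classical all_reals.

Set Implicit Arguments.
Unset Strict Implicit.
Unset Printing Implicit Defensive.

Import Order.TTheory GRing.Theory Num.Theory.

Local Open Scope fset_scope.
Local Open Scope classical_set_scope.
Local Open Scope ring_scope.

Definition is_box (R : realType) (d m : nat) (B : set 'rV[R]_d) : Prop :=
  exists a b : 'rV[R]_d,
    [/\ forall j, a 0 j <= b 0 j,
        #|[set j : 'I_d | a 0 j < b 0 j]%SET| = m
      & B = [set x | forall j, x 0 j \in `[a 0 j, b 0 j]] ].

Definition pierceable (T : choiceType) (n : nat) (F : set (set T)) : Prop :=
  exists P : {fset T}, #|` P| = n /\
    forall A, F A -> exists2 p, p \in P & A p.

(* The value of h(d, m, 2); it depends only on m. *)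
Definition helly2 (m : nat) : nat :=
  (if m == 1 then 5
   else if m == 2 then 7
   else if odd m then 3 * m
   else 3 * m - 1)%N.

(* Main.v *)
(* For each axis j let a_j be the least right end and b_j the greatest left end
   of the intervals of the family. If a box misses both a_j and b_j on some axis,
   three boxes are pairwise disjoint. Otherwise two piercing points may be taken
   to be opposite corners of the box spanned by a and b, and a box that misses
   a_j or b_j on several axes only relates the corner choices on these axes: it
   is a parity constraint on signs. Parity constraints are unsatisfiable iff they
   contain an unbalanced closed walk, that is a walk from some (j, c) to
   (j, ~~ c) in the double cover J * bool of the graph of axes.
   In a shortest such walk, of length k, let q be the number of axes at which
   the two consecutive boxes miss different ends; q is odd. The k boxes of the
   walk together with one witness (a box ending at a_j or starting at b_j) at the
   other axes and two witnesses at those q' of the q axes where the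
   consecutive boxes overlap cannot be pierced, so 2k - q + 2q' boxes suffice.
   If k > 2, minimality of the walk makes each of its boxes miss a_j or b_j
   on exactly two of the k axes, so it is nondegenerate on the k - 2 other ones,
   whence k <= m + 2; an overlap makes both boxes nondegenerate on the axis,
   whence 2q' <= k (m + 2 - k). *)

Require Import Defs.
From mathcomp Require Import all_boot all_order all_algebra finmap.
From mathcomp Require Import all_classical all_reals.
From mathcomp Require Import zify.

Import Order.TTheory GRing.Theory Num.Theory.

Set Implicit Arguments.
Unset Strict Implicit.
Unset Printing Implicit Defensive.

(** * Walks and signings in a graph with an involution *)

Lemma connect_walk (V : finType) (e : rel V) (x y : V) :
  connect e x y ->
  exists n (u : nat -> V),
    [/\ forall i, i < n -> e (u i) (u i.+1), u 0 = x & u n = y].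
Proof.
case/connectP=> p /(pathP x) xp ->; exists (size p), (nth x (x :: p)).
by split=> //; rewrite (last_nth x).
Qed.

(** A shortest walk from some [y] to [s y], over all [y], is continued by applying [s] once more
    after every [k] steps, so that later indices need no reduction modulo [k]. *)
Lemma shortest_twisted_walk (V : finType) (e : rel V) (s : V -> V) (x : V) :
  {mono s : y z / e y z} -> (forall y, s y <> y) -> connect e x (s x) ->
  exists k (w : nat -> V),
    [/\ forall i, e (w i) (w i.+1), forall i, w (i + k) = s (w i)
      & forall n (u : nat -> V), (forall i, i < n -> e (u i) (u i.+1)) ->
          u n = s (u 0) -> k <= n].
Proof.
move=> es s_free /connect_walk[n0 [u0 [u0e u00 u0n]]].
pose P n := `[< exists u : nat -> V,
  (forall i, i < n -> e (u i) (u i.+1)) /\ u n = s (u 0) >].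
have exP : exists n, P n by exists n0; apply/asboolP; exists u0; rewrite u0n u00.
case: (ex_minnP exP) => k /asboolP[u [ue uk]] kmin.
have {}kmin n (u' : nat -> V) : (forall i, i < n -> e (u' i) (u' i.+1)) ->
    u' n = s (u' 0) -> k <= n.
  by move=> u'e u'n; apply: kmin; apply/asboolP; exists u'.
have k_gt0 : 0 < k by case: posnP uk => // -> /esym/s_free.
pose w i := iter (i %/ k) s (u (i %% k)).
(* The case [r = k] covers the step from one block to the next. *)
have wE q r : r <= k -> w (q * k + r) = iter q s (u r).
  rewrite leq_eqVlt => /predU1P[->|rk].
    by rewrite /w -mulSnr mulnK // modnMl iterSr uk.
  by rewrite /w divnMDl // divn_small // addn0 modnMDl modn_small.
have lt_mod i : i %% k < k by rewrite ltn_pmod.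
exists k, w; split=> // i.
  rewrite (divn_eq i k) -addnS !wE ?(ltnW (lt_mod i)) //.
  by elim: (i %/ k) => [|q IHq] /=; [exact: ue | rewrite es].
by rewrite {1}(divn_eq i k) addnAC -mulSnr wE ?(ltnW (lt_mod i)).
Qed.

(** The involution swaps the distinct components of [(j, false)] and [(j, true)]. The sign records
    which has the smaller rank; an edge matches the two pairs, straight or swapped according to its
    parity. *)
Lemma consistent_signs (J : finType) (e : rel (J * bool)) :
  symmetric e -> (forall i b j c, e (i, ~~ b) (j, ~~ c) = e (i, b) (j, c)) ->
  (forall j, ~~ connect e (j, false) (j, true)) ->
  exists s : J -> bool,
    forall i b j c, e (i, b) (j, c) -> s i (+) s j = b (+) c.
Proof.
move=> esym eN unlinked; have csym := sym_connect_sym esym.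
pose rt b j := enum_rank (fingraph.root e (j, b)).
have rtN j : rt false j <> rt true j :> nat.
  by move=> /ord_inj/enum_rank_inj/(fingraph.rootP csym); apply/negP.
have rte i b j c : e (i, b) (j, c) -> rt b i = rt c j.
  by move=> eij; congr enum_rank; apply/(fingraph.rootP csym)/connect1.
exists (fun j => rt false j < rt true j) => i b j c eij.
have := rte _ _ _ _ eij; rewrite -eN in eij; have := rte _ _ _ _ eij.
have := rtN i; have := rtN j.
by case: b c {eij} => [] [] /= rj ri -> ->; rewrite ?addbb //; lia.
Qed.

(** * Cardinalities and the final arithmetic *)

Lemma card_bigcup_leq (T I : finType) (A : I -> {set T}) :
  #|(\bigcup_i A i)%SET| <= \sum_i #|A i|.
Proof.
elim/big_rec2: _ => [|i n B _ leB]; first by rewrite cards0.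
by rewrite (leq_trans (leq_card_setU _ _)) // leq_add2l.
Qed.

Lemma superset_of_card (T : finType) (A : {set T}) (n : nat) :
  #|A| <= n <= #|T| -> exists2 B : {set T}, A \subset B & #|B| = n.
Proof.
case/andP; elim: n => [|n IHn]; first by rewrite leqn0 => /eqP; exists A.
rewrite leq_eqVlt => /predU1P[|/IHn{}IHn nT]; first by exists A.
have [B AB Bn] := IHn (ltnW nT).
have /set0Pn[x] : (~: B)%SET != finset.set0.
  by rewrite -card_gt0 cardsCs finset.setCK Bn subn_gt0.
rewrite finset.inE => xB; exists (x |: B)%SET; last by rewrite cardsU1 xB Bn.
by rewrite (fintype.subset_trans AB) // finset.subsetUr.
Qed.

(** As [q' <= q <= k], the bound 2k - q + 2q' is at most 3k, and smaller for even k since q is odd: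
    this gives 3m and 3m - 1 when k <= m. The values 5 and 7 are 2m + 3, the bound for k = m + 2,
    where q' = 0. *)
Lemma helly2_bound (k m q q' N : nat) :
  0 < m -> 1 < k -> odd q -> q' <= q <= k -> N + q <= k.*2 + q'.*2 ->
  (2 < k -> k <= m.+2 /\ q'.*2 <= k * (m.+2 - k)) -> N <= helly2 m.
Proof.
move=> m_gt0 k_gt1 q_odd /andP[q'q qk] Nq kb; rewrite /helly2.
have [k2|k_gt2] : k = 2 \/ 2 < k by lia.
  by do ?case: ifP => ?; lia.
have [km q'k] := kb k_gt2.
have [kE|[kE|km']] : k = m.+2 \/ k = m.+1 \/ k <= m by lia.
- have {}q'k : q' = 0 by move: q'k; rewrite kE subnn muln0; lia.
  by do ?case: ifP => ?; lia.
- have {}q'k : q'.*2 <= k by move: q'k; rewrite kE subSnn muln1.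
  by do ?case: ifP => ?; lia.
by do ?case: ifP => ?; lia.
Qed.

(** * Boxes over a total order: extreme ends and corners *)

Section Intervals.
Context (disp : Order.disp_t) (R : orderType disp).
Context (I J : finType) (l r : I -> J -> R).
Implicit Types (i : I) (j : J) (p : J -> R) (G : {set I}).

Definition contains i p := [forall j, (l i j <= p j <= r i j)%O].

Definition pierced G p p' := forall i, i \in G -> contains i p || contains i p'.

Lemma contains_meet i i' j p :
  contains i p -> contains i' p -> (l i j <= r i' j)%O.
Proof.
by move=> /forallP/(_ j)/andP[lp _] /forallP/(_ j)/andP[_ pr]; apply: le_trans pr.
Qed.

Context (le_lr : forall i j, (l i j <= r i j)%O) (i0 : I).

Definition first_end j := [arg min_(i < i0) r i j]%O.
Definition last_start j := [arg max_(i > i0) l i j]%O.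

Let a j := r (first_end j) j.
Let b j := l (last_start j) j.

Lemma first_end_le i j : (a j <= r i j)%O.
Proof. by rewrite /a /first_end; case: arg_minP => // i1 _; apply. Qed.

Lemma last_start_ge i j : (l i j <= b j)%O.
Proof. by rewrite /b /last_start; case: arg_maxP => // i1 _; apply. Qed.

Definition above i j := (a j < l i j)%O.
Definition below i j := (r i j < b j)%O.
Definition constrained i j := above i j || below i j.

Lemma first_end_lt_last_start i j : constrained i j -> (a j < b j)%O.
Proof.
by case/orP=> [/lt_le_trans|/(le_lt_trans (first_end_le i j))//];
   apply; apply: last_start_ge.
Qed.

Lemma above_below_unpierced i j p p' :
  above i j -> below i j -> ~ pierced [set first_end j; i; last_start j]%SET p p'.
Proof.
move=> ij ji G; have iG := G i; have fG := G (first_end j).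
have lG := G (last_start j); rewrite !finset.inE !eqxx ?orbT in iG fG lG.
have fi q : contains i q -> contains (first_end j) q -> False.
  by move=> ci cf; have := contains_meet j ci cf; rewrite leNgt [(_ < _)%O]ij.
have il q : contains (last_start j) q -> contains i q -> False.
  by move=> ci cf; have := contains_meet j ci cf; rewrite leNgt [(_ < _)%O]ji.
have fl q : contains (last_start j) q -> contains (first_end j) q -> False.
  move=> ci cf; have := contains_meet j ci cf; rewrite leNgt.
  by rewrite [(_ < _)%O](@first_end_lt_last_start i) // /constrained ij.
by case/orP: (iG isT) => [] iq; case/orP: (fG isT) => [] fq;
   case/orP: (lG isT) => [] lq;
   first [exact: (fi _ iq fq) | exact: (il _ lq iq) | exact: (fl _ lq fq)].
Qed.

Context (above_below : forall i j, above i j -> ~~ below i j).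

Lemma belowE i j : constrained i j -> below i j = ~~ above i j.
Proof.
by rewrite /constrained; case: (boolP (above i j)) => //= /above_below/negbTE.
Qed.

Definition corner (s : J -> bool) j := if s j then b j else a j.

(** On an unconstrained axis the interval contains both [a j] and [b j]; on a constrained one it
    contains exactly one, namely [b j] if [above i j]. *)
Lemma contains_corner i (s : J -> bool) :
  (forall j, constrained i j -> s j = above i j) -> contains i (corner s).
Proof.
move=> si; apply/forallP => j; rewrite /corner; have {si} := si j.
have := first_end_le i j; have := last_start_ge i j; rewrite /constrained.
have [ij lb ar ->//|] := boolP (above i j).
  by rewrite lb leNgt; apply: above_below.
rewrite /above -leNgt => la; have [ij lb ar ->//|] := boolP (below i j).
  by rewrite la.
by rewrite /below -leNgt => br lb ar _; case: ifP; rewrite ?la ?lb ?ar ?br.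
Qed.

Lemma consistent_pierced (s : J -> bool) :
  (forall i j j', constrained i j -> constrained i j' ->
     s j (+) above i j = s j' (+) above i j') ->
  pierced [set: I]%SET (corner s) (corner (negb \o s)).
Proof.
move=> s_ok i _; case: (pickP (constrained i)) => [j ij|un].
  case sj: (s j (+) above i j).
    apply/orP; right; apply: contains_corner => j' ij' /=.
    by have := s_ok i j j' ij ij'; rewrite sj; case: (s j') (above _ _) => [] [].
  apply/orP; left; apply: contains_corner => j' ij' /=.
  by have := s_ok i j j' ij ij'; rewrite sj; case: (s j') (above _ _) => [] [].
by apply/orP; left; apply: contains_corner => j; rewrite un.
Qed.

(** * Witness boxes *)

Definition overlap i i' j := ((l i j <= r i' j) && (l i' j <= r i j))%O.

(* Boxes that force i and i' to contain the same piercing point if they miss the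
   same end on axis j, and different ones if they miss different ends. *)
Definition witnesses i i' j : {set I} :=
  (if above i j (+) above i' j
   then if overlap i i' j then [set first_end j; last_start j] else finset.set0
   else [set if above i j then first_end j else last_start j])%SET.

(** Summed over the walk and added to its k boxes, this yields 2k - q + 2q' without subtraction. *)
Lemma card_witnesses i i' j :
  #|witnesses i i' j| + (above i j (+) above i' j) <=
  1 + ((above i j (+) above i' j) && overlap i i' j).*2.
Proof.
rewrite /witnesses; case: (_ (+) _) => /=; last by rewrite cards1.
by case: overlap; rewrite ?cards0 // cards2; case: eqP.
Qed.

(** A single witness is disjoint from both boxes, so they share the other point. Two witnesses are
    disjoint from each other and each misses one of the boxes, which separates these; without
    overlap the boxes are separated anyway. *)
Lemma witnesses_spec i i' j G p p' :
  constrained i j -> constrained i' j ->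
  i \in G -> i' \in G -> witnesses i i' j \subset G -> pierced G p p' ->
  contains i' p = contains i p (+) above i j (+) above i' j.
Proof.
move=> ij ij' iG i'G wG pG.
have dis x y q : (r x j < l y j)%O -> contains x q && contains y q = false.
  by move=> xy; apply/andP => -[cx cy]; have := contains_meet j cy cx;
    rewrite leNgt xy.
have fG : first_end j \in witnesses i i' j ->
    contains (first_end j) p || contains (first_end j) p'.
  by move=> /(fintype.subsetP wG)/pG.
have lG : last_start j \in witnesses i i' j ->
    contains (last_start j) p || contains (last_start j) p'.
  by move=> /(fintype.subsetP wG)/pG.
have fi x q : above x j -> contains (first_end j) q && contains x q = false.
  exact: dis.
have il x q : below x j -> contains x q && contains (last_start j) q = false.
  exact: dis.
have fl q : contains (first_end j) q && contains (last_start j) q = false.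
  exact: dis (first_end_lt_last_start ij).
have {dis}ii' q : ~~ overlap i i' j -> contains i q && contains i' q = false.
  by rewrite negb_and -!ltNge => /orP[|]/(dis _ _ q) // <-; rewrite andbC.
have := pG _ i'G; have := pG _ iG; move: fG lG (fl p) (fl p').
have := fi i p; have := fi i p'; have := fi i' p; have := fi i' p'.
have := il i p; have := il i p'; have := il i' p; have := il i' p'.
have := ii' p; have := ii' p'; rewrite !belowE // /witnesses.
move: (contains i p) (contains i p') (contains i' p) (contains i' p').
move: (contains _ p) (contains _ p') (contains _ p) (contains _ p').
by case: (above i j) (above i' j) (overlap i i' j) => [] [] [] /=;
   rewrite !finset.inE ?eqxx ?orbT; clear; lia.
Qed.

Lemma overlapC i i' j : overlap i i' j = overlap i' i j.
Proof. exact: andbC. Qed.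

(** If [i] were a point on this axis, meeting a box that misses the opposite end would make it miss
    both ends. *)
Lemma overlap_nondegenerate i i' j :
  constrained i j -> constrained i' j -> above i j (+) above i' j ->
  overlap i i' j -> (l i j < r i j)%O.
Proof.
move=> ij i'j; rewrite lt_neqAle le_lr andbT.
case: (boolP (above i j)) => ai /=.
  rewrite -belowE // => bi' /andP[li _].
  apply: contraNneq (above_below ai) => lr.
  by rewrite /below -lr (le_lt_trans li).
move=> ai' /andP[_ ri]; apply: contraNneq ai => lr.
by rewrite /above lr (lt_le_trans ai').
Qed.

(** * The double cover of the graph of axes *)

(* (j, c) stands for the choice of the corner coordinate [b j] if c, [a j] if
   not, so [flip] passes to the opposite corner. *)
Definition flip (x : J * bool) := (x.1, ~~ x.2).

(** By the parity constraint of box [i], the choices [x] and [y] force each other. *)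
Definition adjacent i (x y : J * bool) :=
  [&& constrained i x.1, constrained i y.1
    & x.2 (+) above i x.1 == y.2 (+) above i y.1].

Definition linked x y := [exists i, adjacent i x y].

Lemma adjacent_flip i : {mono flip : x y / adjacent i x y}.
Proof. by move=> x y; rewrite /adjacent /= !addNb (inj_eq negb_inj). Qed.

Lemma adjacentC i x y : adjacent i x y = adjacent i y x.
Proof. by rewrite /adjacent andbCA eq_sym. Qed.

Lemma linked_flip : {mono flip : x y / linked x y}.
Proof. by move=> x y; apply: eq_existsb => i; rewrite adjacent_flip. Qed.

Lemma linkedC : symmetric linked.
Proof. by move=> x y; apply: eq_existsb => i; rewrite adjacentC. Qed.

Lemma linked_irrefl x : ~~ linked x (flip x).
Proof.
by apply/existsP => -[i /and3P[_ _]]; rewrite addNb; case: (_ (+) _).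
Qed.

Lemma unpierced_twisted_connect :
  (forall p p', ~ pierced [set: I]%SET p p') ->
  exists x, connect linked x (flip x).
Proof.
move=> unp; apply: contrapT => /forallNP unlinked.
have lN (i : J) c j c' : linked (i, ~~ c) (j, ~~ c') = linked (i, c) (j, c').
  exact: (linked_flip (i, c) (j, c')).
have unl j : ~~ connect linked (j, false) (j, true).
  by apply/negP; apply: (unlinked (j, false)).
have [s sP] := consistent_signs linkedC lN unl.
apply: (unp _ _ (@consistent_pierced s _)) => i j j' ij ij'.
have := sP j (above i j) j' (above i j').
have -> : linked (j, above i j) (j', above i j').
  by apply/existsP; exists i; rewrite /adjacent /= ij ij' !addbb.
by move=> /(_ isT); case: (s j) (s j') (above i j) (above i j') => [] [] [] [].
Qed.

(** * The family read off a shortest twisted walk *)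

Section Cycle.
Context (k : nat) (w : nat -> J * bool).
Context (w_linked : forall n, linked (w n) (w n.+1)).
Context (w_flip : forall n, w (n + k) = flip (w n)).
Context (w_shortest : forall n (u : nat -> J * bool),
  (forall t, t < n -> linked (u t) (u t.+1)) -> u n = flip (u 0) -> k <= n).

Let v n := (w n).1.
(** [pick] depends only on the predicate, which [flip] preserves, so the chosen boxes have period k.
    As consecutive vertices are linked, the default [i0] is never returned. *)
Let edge n := odflt i0 [pick i | adjacent i (w n) (w n.+1)].
(* [v n.+1] is one of the q axes. *)
Let turn n := above (edge n) (v n.+1) (+) above (edge n.+1) (v n.+1).
Let clash n := turn n && overlap (edge n) (edge n.+1) (v n.+1).
Let wide i j : bool := (l i j < r i j)%O.

Lemma edgeP n : adjacent (edge n) (w n) (w n.+1).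
Proof.
rewrite /edge; case: pickP => //= none.
by have /existsP[i] := w_linked n; rewrite none.
Qed.

Lemma edge_constrained n : constrained (edge n) (v n).
Proof. by have /and3P[] := edgeP n. Qed.

Lemma edge_constrainedS n : constrained (edge n) (v n.+1).
Proof. by have /and3P[] := edgeP n. Qed.

Lemma edge_period n : edge (n + k) = edge n.
Proof.
by congr odflt; apply: eq_pick => i; rewrite -addSn !w_flip adjacent_flip.
Qed.

Lemma v_period n : v (n + k) = v n.
Proof. by rewrite /v w_flip. Qed.

(** The parity [c n] changes exactly at turns; after k steps box and axis recur but the choice is
    flipped. *)
Lemma sum_turn_odd : odd (\sum_(n < k) turn n).
Proof.
pose c n := (w n).2 (+) above (edge n) (v n).
have cE n : odd (\sum_(t < n) turn t) = c 0 (+) c n.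
  elim: n => [|n IHn]; first by rewrite big_ord0 addbb.
  rewrite big_ord_recr oddD oddb IHn /c /turn.
  have /and3P[_ _ /eqP->] := edgeP n; rewrite -/(v n.+1).
  by rewrite -!addbA; congr (_ (+) (_ (+) (_ (+) _))); rewrite addbA addbb.
by rewrite cE /c -(add0n k) edge_period v_period w_flip addNb addbN addbb.
Qed.

Definition cycle_family : {set I} :=
  (\bigcup_(n < k) (edge n |: witnesses (edge n) (edge n.+1) (v n.+1)))%SET.

(** Whether [edge n] contains [p] would change at each turn, hence an odd number of times on the way
    back to [edge 0]. *)
Lemma cycle_family_unpierced p p' : ~ pierced cycle_family p p'.
Proof.
move=> pG; have eG n : n <= k -> edge n \in cycle_family.
  have k_gt0 : 0 < k by case: posnP sum_turn_odd => // ->; rewrite big_ord0.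
  rewrite leq_eqVlt => /predU1P[->|nk]; apply/bigcupP.
    by exists (Ordinal k_gt0) => //; rewrite (edge_period 0) setU11.
  by exists (Ordinal nk); rewrite ?setU11.
have cE n : n <= k ->
    contains (edge n) p = contains (edge 0) p (+) odd (\sum_(t < n) turn t).
  elim: n => [|n IHn] nk; first by rewrite big_ord0 addbF.
  rewrite big_ord_recr oddD oddb addbA -IHn ?(ltnW nk) //= /turn addbA.
  apply: (witnesses_spec (edge_constrainedS n) (edge_constrained n.+1)) pG.
  - exact/eG/ltnW.
  - exact: eG.
  apply: fintype.subset_trans (finset.bigcup_sup (Ordinal nk) _) => //.
  exact: finset.subsetUr.
have := cE k (leqnn k); rewrite -{1}(add0n k) edge_period sum_turn_odd.
by case: contains.
Qed.

Lemma card_cycle_family :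
  #|cycle_family| + \sum_(n < k) turn n <= k.*2 + (\sum_(n < k) clash n).*2.
Proof.
have -> : k.*2 + (\sum_(n < k) clash n).*2 = \sum_(n < k) (2 + (clash n).*2).
  by rewrite (big_morph _ doubleD double0) big_split sum_nat_const card_ord muln2.
apply: (leq_trans (leq_add (card_bigcup_leq _) (leqnn _))).
rewrite -big_split leq_sum //= => n _.
by rewrite cardsU1 -addnA (leq_add (leq_b1 (_ \notin _)) (card_witnesses _ _ _)).
Qed.

(** * Consequences of minimality *)

Lemma closing_link y n : linked (w (y + n)) (flip (w y)) -> k <= n.+1.
Proof.
move=> closing; pose u t := if t <= n then w (y + t) else flip (w y).
apply: (w_shortest (u := u)); last by rewrite /u ltnn addn0.
move=> t; rewrite ltnS => tn; rewrite /u tn; case: ltnP => [_|nt].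
  by rewrite addnS.
by have -> : t = n by apply/eqP; rewrite eqn_leq tn nt.
Qed.

Lemma cycle_length_gt1 : 1 < k.
Proof.
case: k w_flip => [|[|//]] flip_w.
  by have := flip_w 0; rewrite addn0; case: (w 0) => j [].
by have := w_linked 0; rewrite -(addn1 0) flip_w (negbTE (linked_irrefl _)).
Qed.

(** If [w z] is [flip (w y)], the arc from y to z is a shorter twisted walk; if it is [w y], the arc
    from z to y + k is. *)
Lemma cycle_vertices_neq y z : y < z < y + k -> v y != v z.
Proof.
case/andP=> yz zyk; apply/eqP => vyz.
have wmin a0 n : w (a0 + n) = flip (w a0) -> k <= n.
  by move=> wn; apply: (w_shortest (u := fun t => w (a0 + t))) => [t _|];
      rewrite ?addnS ?addn0.
have [wyz|wyz] : w z = w y \/ w z = flip (w y).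
  move: vyz; rewrite /v /flip; case: (w y) (w z) => [j []] [_ []] /= <-; tauto.
  have := wmin z (y + k - z); rewrite subnKC ?(ltnW zyk) //.
  by rewrite w_flip wyz => /(_ erefl); lia.
by have := wmin y (z - y); rewrite subnKC ?(ltnW yz) // wyz => /(_ erefl); lia.
Qed.

(** Here [z] runs over the k - 2 axes of a period other than the two ends of [edge x]. *)
Lemma edge_unconstrained x z : x.+1 < z < x + k -> ~~ constrained (edge x) (v z).
Proof.
case/andP=> xz zxk; apply/negP => cz; have /and3P[cx cx1 /eqP eq_x] := edgeP x.
(* In either case [edge x] is a chord closing one of the two arcs cut by z. *)
have [eq_z|neq_z] := eqVneq ((w x).2 (+) above (edge x) (v x))
                            ((w z).2 (+) above (edge x) (v z)).
  have := @closing_link z (x + k - z); rewrite subnKC ?(ltnW zxk) // w_flip.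
  rewrite linked_flip.
  suff -> : linked (w x) (w z) by move=> /(_ isT); move: xz zxk; clear; lia.
  by apply/existsP; exists (edge x); rewrite /adjacent cx cz; apply/eqP.
have := @closing_link x.+1 (z - x.+1); rewrite subnKC ?(ltnW xz) //.
suff -> : linked (w z) (flip (w x.+1)).
  by move=> /(_ isT); move: xz zxk; clear; lia.
apply/existsP; exists (edge x); rewrite /adjacent cx1 cz /= addNb -eq_x.
by move: neq_z; rewrite /v; case: (_ (+) _) (_ (+) _) => [] [].
Qed.

Context (m : nat) (m_wide : forall i, #|[set j | wide i j]%SET| <= m).

Lemma wide_edge_bound x : 2 < k ->
  wide (edge x) (v x) + wide (edge x) (v x.+1) + (k - 2) <= m.
Proof.
move=> k_gt2; pose f (n : 'I_k) := v (x + n).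
have f_inj : injective f.
  move=> n n' /eqP ff; apply/val_inj; case: (ltngtP n n') => // nn'.
    move: ff; rewrite (negbTE (@cycle_vertices_neq (x + n) (x + n') _)) //.
    by rewrite ltn_add2l nn' /=; have := ltn_ord n'; lia.
  move: ff; rewrite eq_sym (negbTE (@cycle_vertices_neq (x + n') (x + n) _)) //.
  by rewrite ltn_add2l nn' /=; have := ltn_ord n; lia.
(* Being unconstrained there, the box contains both ends, which differ because another box of the
   walk is constrained on that axis. *)
have wide_rest n : 1 < n < k -> wide (edge x) (v (x + n)).
  case/andP=> n1 nk; have := @edge_unconstrained x (x + n).
  rewrite ltn_add2l nk -addn1 ltn_add2l n1 => /(_ isT).
  rewrite /constrained negb_or /above /below -!leNgt => /andP[la rb].
  apply: (le_lt_trans la); apply: lt_le_trans rb.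
  exact: first_end_lt_last_start (edge_constrained (x + n)).
have : \sum_(n < k) wide (edge x) (f n) <= m.
  apply: leq_trans (m_wide (edge x)).
  rewrite -big_mkcond sum1_card -(card_imset _ f_inj) subset_leq_card //.
  by apply/fintype.subsetP => _ /imsetP[n wn ->]; rewrite finset.inE.
apply: leq_trans; have -> : \sum_(n < k) wide (edge x) (f n) =
    \sum_(0 <= n < k) wide (edge x) (v (x + n)) by rewrite big_mkord.
rewrite big_ltn ?(ltn_trans _ k_gt2) // big_ltn ?(ltn_trans _ k_gt2) //.
rewrite addn0 addn1 -addnA !leq_add2l big_nat.
rewrite (eq_bigr (fun=> 1)) => [|n nk]; last by rewrite wide_rest.
by rewrite -big_nat sum_nat_const_nat muln1.
Qed.

(** Each clash makes two consecutive boxes nondegenerate on their common axis. Regrouped by box, at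
    most m + 2 - k such incidences belong to each. *)
Lemma clash_bound : 2 < k ->
  k <= m.+2 /\ (\sum_(n < k) clash n).*2 <= k * (m.+2 - k).
Proof.
move=> k_gt2; split; first by have := wide_edge_bound 0 k_gt2; lia.
have wide_end n : wide (edge n) (v n) + wide (edge n) (v n.+1) <= m.+2 - k.
  by have := wide_edge_bound n k_gt2; lia.
have clash_wide n : (clash n).*2 <=
    wide (edge n) (v n.+1) + wide (edge n.+1) (v n.+1).
  case: (boolP (clash n)) => // /andP[tn on].
  have cn := edge_constrainedS n; have cn1 := edge_constrained n.+1.
  rewrite /wide (overlap_nondegenerate cn cn1 tn on).
  rewrite (@overlap_nondegenerate _ (edge n) _ cn1 cn) //; first by rewrite addbC.
  by rewrite overlapC.
have shift (f : nat -> nat) : f k = f 0 -> \sum_(n < k) f n.+1 = \sum_(n < k) f n.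
  move=> fk; apply/(@addnI (f 0)); have := @big_ord_recr _ 0 addn k f.
  by rewrite big_ord_recl /= fk [RHS]addnC.
rewrite (big_morph _ doubleD double0).
apply: (@leq_trans (\sum_(n < k)
    (wide (edge n) (v n.+1) + wide (edge n.+1) (v n.+1)))).
  by apply: leq_sum => n _; apply: clash_wide.
rewrite big_split /= (shift (fun n => wide (edge n) (v n))); last first.
  by rewrite (edge_period 0) (v_period 0).
have -> : k * (m.+2 - k) = \sum_(n < k) (m.+2 - k).
  by rewrite sum_nat_const card_ord.
rewrite -big_split; apply: leq_sum => n _ /=.
by rewrite addnC wide_end.
Qed.

Lemma card_cycle_family_helly2 : 0 < m -> #|cycle_family| <= helly2 m.
Proof.
move=> m_gt0.
apply: helly2_bound m_gt0 cycle_length_gt1 sum_turn_odd _ card_cycle_family _;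
  last exact: clash_bound.
apply/andP; split.
  by apply: leq_sum => n _; rewrite /clash; case: (turn n); case: overlap.
have -> : \sum_(n < k) turn n <= k = (\sum_(n < k) turn n <= \sum_(n < k) 1).
  by rewrite sum1_card card_ord.
by apply: leq_sum => n _; apply: leq_b1.
Qed.

End Cycle.
End Intervals.

(** * From interval systems back to boxes *)

Lemma small_unpierced (disp : Order.disp_t) (R : orderType disp) (I J : finType)
    (l r : I -> J -> R) (m : nat) (i0 : I) :
  0 < m -> (forall i j, (l i j <= r i j)%O) ->
  (forall i, #|[set j | (l i j < r i j)%O]%SET| <= m) ->
  (forall p p', ~ pierced l r [set: I]%SET p p') ->
  exists2 G : {set I}, #|G| <= helly2 m & forall p p', ~ pierced l r G p p'.
Proof.
move=> m_gt0 le_lr m_wide unp.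
have [[i [j [ij ji]]]|ab] :=
    pselect (exists i j, above l r i0 i j /\ below l r i0 i j).
  exists [set first_end r i0 j; i; last_start l i0 j]%SET.
    apply: (@leq_trans 3); last by rewrite /helly2; do ?case: ifP => ?; lia.
    rewrite (leq_trans (leq_card_setU _ _)) // cards1 addn1 ltnS cards2.
    by case: eqP.
  by move=> p p'; apply: above_below_unpierced.
have {}ab i j : above l r i0 i j -> ~~ below l r i0 i j.
  by move=> ij; apply/negP => ji; apply: ab; exists i, j.
have [x cx] := unpierced_twisted_connect ab unp.
have flip_free (y : J * bool) : flip y <> y by case: y => j [].
have [k [w [w_linked w_flip w_shortest]]] :=
  shortest_twisted_walk (linked_flip l r i0) flip_free cx.
exists (cycle_family l r i0 k w).
  exact: (card_cycle_family_helly2 le_lr ab w_linked w_flip w_shortest m_wide).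
by move=> p p'; apply: (cycle_family_unpierced ab w_linked w_flip).
Qed.

(** [pierceable 2] asks for distinct points; if [p = p'], one of [x0], [x1] supplies the second. *)
Lemma pierceable2P (T : choiceType) (F : set (set T)) (x0 x1 : T) : x0 <> x1 ->
  pierceable 2 F <-> exists p p', forall A, F A -> A p \/ A p'.
Proof.
move=> x01; split=> [[P [P2 PF]]|[p [p' pF]]].
  have [p [p' Pp]] : exists p p', P =i [:: p; p'].
    by case: P P2 {PF} => -[|p [|p' []]] //= ? _; exists p, p'.
  exists p, p' => A /PF[y]; rewrite Pp !inE => /orP[]/eqP->; tauto.
have [q [pq qF]] : exists q, p <> q /\ forall A, F A -> A p \/ A q.
  have [pp'|] := pselect (p = p'); last by exists p'.
  have [px|px] := pselect (p = x0); [exists x1|exists x0]; split; rewrite ?px //.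
    by move=> A /pF; rewrite -pp' px; tauto.
  by move=> A /pF; rewrite -pp'; tauto.
exists [fset p; q]%fset; split; first by rewrite cardfs2; case: eqP.
by move=> A /qF[]; [exists p|exists q]; rewrite // !inE eqxx ?orbT.
Qed.

Local Open Scope classical_set_scope.
Local Open Scope fset_scope.

Theorem theorem3 (R : realType) (d m : nat) (m_gt0 : (0 < m)%N)
    (m_le_d : (m <= d)%N) (F : {fset (set 'rV[R]_d)})
    (F_box : forall B : set 'rV[R]_d, B \in F -> is_box m B) :
  pierceable 2 [set` F] <->
  (forall G : {fset (set 'rV[R]_d)}, G `<=` F ->
     (#|` G| = helly2 m \/ (#|` F| < helly2 m)%N) ->
     pierceable 2 [set` G]).
Proof.
split=> [[P [P2 PF]] G GF _|HG].
  by exists P; split=> // A /(fsubsetP GF)/PF.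
have [|hF] := ltnP #|` F| (helly2 m); first by move=> hF; apply: HG => //; right.
have rV01 : (0 : 'rV[R]_d)%R <> const_mx 1%R.
  by move/rowP/(_ (Ordinal (leq_trans m_gt0 m_le_d))); rewrite !mxE;
    move=> /esym/eqP; rewrite oner_eq0.
have /choice[ab abP] (B : F) : exists ab : 'rV[R]_d * 'rV[R]_d,
    [/\ forall j, (ab.1 ord0 j <= ab.2 ord0 j)%R,
        #|[set j | (ab.1 ord0 j < ab.2 ord0 j)%R]%SET| = m
      & forall x, val B x <->
          forall j, (ab.1 ord0 j <= x ord0 j <= ab.2 ord0 j)%R].
  have [a [b [le_ab abm Bab]]] := F_box _ (valP B).
  exists (a, b); split=> // x; rewrite Bab /=.
  by split=> xab j; have := xab j; rewrite in_itv.
pose l (B : F) j := (ab B).1 ord0 j; pose r (B : F) j := (ab B).2 ord0 j.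
have containsP B x : val B x <-> contains l r B (x ord0).
  have [_ _ BP] := abP B; rewrite BP /contains; split=> [?|/forallP//].
  exact/forallP.
apply: contrapT => unF.
have [B0 _] : exists B0 : F, True.
  apply: contrapT => noF; apply: unF; apply/(pierceable2P _ rV01).
  exists 0%R, 0%R => A AF; case: noF; exists [` AF] => //.
have le_lr B j : (l B j <= r B j)%O by have [+ _ _] := abP B; apply.
have wide_m B : #|[set j | (l B j < r B j)%O]%SET| <= m by have [_ <-] := abP B.
have unp p p' : ~ pierced l r [set: F]%SET p p'.
  move=> pF; apply: unF; apply/(pierceable2P _ rV01).
  exists (\row_j p j)%R, (\row_j p' j)%R => A AF.
  have rowE q : (\row_j q j)%R ord0 = q by apply/funext => j; rewrite mxE.
  by have /orP[] := pF [` AF] (finset.in_setT _); [left|right];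
     apply/(containsP [` AF]); rewrite rowE.
have [G Gh unG] := small_unpierced B0 m_gt0 le_lr wide_m unp.
(* The hypothesis concerns subfamilies of size exactly [helly2 m]; enlarging [G] to that size keeps
   it unpierceable. *)
have [|G' GG' G'h] := @superset_of_card F G (helly2 m).
  by rewrite Gh -cardfE.
have GF : [fset val B | B in G'] `<=` F.
  by apply/fsubsetP => _ /imfsetP[B _ ->]; apply: valP.
have Gcard : #|` [fset val B | B in G']| = helly2 m.
  by rewrite card_imfset /=; [rewrite -G'h cardE | exact: val_inj].
have /(pierceable2P _ rV01)[p [p' pG]] := HG _ GF (or_introl Gcard).
apply: (unG (p ord0) (p' ord0)) => B /(fintype.subsetP GG') BG.
have /pG[/containsP->//|/containsP->] : val B \in [fset val B | B in G'].
  by apply/imfsetP; exists B.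
by rewrite orbT.
Qed.
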